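(* Let $p\in\mathbf{P}$ be a propositional variable. The formula $[Wp]Wp$ is provable in $\mathbf{M}^{W[\cdot]}$.
   Context: Fix a nonempty set $\mathbf{P}$ of propositional variables. The language is $\mathcal{L}(W)$ extended with public announcements: $\varphi::=p\mid\neg\varphi\mid\varphi\land\varphi\mid W\varphi\mid[\varphi]\varphi$ with $p\in\mathbf{P}$; other Boolean connectives are defined as usual. The proof system $\mathbf{M}^{W[\cdot]}$ has as axioms all instances (in this language) of: propositional tautologies; $\texttt{WE}$: $W\varphi\to\neg\varphi$; $\texttt{WM}$: $W(\varphi\land\psi)\land\neg\psi\to W\psi$; and the reduction axioms $\texttt{AP}$: $[\psi]p\leftrightarrow(\psi\to p)$ for $p\in\mathbf{P}$; $\texttt{AN}$: $[\psi]\neg\varphi\leftrightarrow(\psi\to\neg[\psi]\varphi)$; $\texttt{AC}$: $[\psi](\varphi\land\chi)\leftrightarrow([\psi]\varphi\land[\psi]\chi)$; $\texttt{AA}$: $[\psi][\chi]\varphi\leftrightarrow[\psi\land[\psi]\chi]\varphi$; $\texttt{AW}$: $[\psi]W\varphi\leftrightarrow(\psi\to W[\psi]\varphi)$. Its rules are modus ponens and $\texttt{REW}$: from $\varphi\leftrightarrow\psi$ infer $W\varphi\leftrightarrow W\psi$. *)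

(* Defs.v *)
Inductive form (P : Type) : Type :=
| Var : P -> form P
| Neg : form P -> form P
| And : form P -> form P -> form P
| W : form P -> form P
| Ann : form P -> form P -> form P.

Arguments Var {P} _.
Arguments Neg {P} _.
Arguments And {P} _ _.
Arguments W {P} _.
Arguments Ann {P} _ _.

Definition Imp {P : Type} (A B : form P) : form P := Neg (And A (Neg B)).
Definition Iff {P : Type} (A B : form P) : form P := And (Imp A B) (Imp B A).

Declare Scope form_scope.
Delimit Scope form_scope with form.
Bind Scope form_scope with form.
Notation "'!' A" := (Neg A) (at level 35, right associativity) : form_scope.
Notation "A '&' B" := (And A B) (at level 40, left associativity) : form_scope.
Notation "A '~>' B" := (Imp A B) (at level 55, right associativity) : form_scope.
Notation "A '<~>' B" := (Iff A B) (at level 60, no associativity) : form_scope.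
Notation "'[!' A ']' B" := (Ann A B) (at level 35, A at level 99, B at level 35,
  right associativity, format "[! A ] B") : form_scope.

(* Purely propositional schemes; the letters are placeholders for arbitrary
   formulas of the full language, not elements of [P]. *)
Inductive scheme : Type :=
| SVar : nat -> scheme
| SNeg : scheme -> scheme
| SAnd : scheme -> scheme -> scheme.

Fixpoint eval (v : nat -> bool) (s : scheme) : bool :=
  match s with
  | SVar n => v n
  | SNeg s => negb (eval v s)
  | SAnd s t => andb (eval v s) (eval v t)
  end.

Definition tautology (s : scheme) : Prop := forall v : nat -> bool, eval v s = true.

Fixpoint inst {P : Type} (sigma : nat -> form P) (s : scheme) : form P :=
  match s with
  | SVar n => sigma n
  | SNeg s => Neg (inst sigma s)
  | SAnd s t => And (inst sigma s) (inst sigma t)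
  end.

Inductive provable {P : Type} : form P -> Prop :=
| Taut (s : scheme) (sigma : nat -> form P) : tautology s -> provable (inst sigma s)
| WE (A : form P) : provable (W A ~> ! A)
| WM (A B : form P) : provable (W (A & B) & ! B ~> W B)
| AP (B : form P) (p : P) : provable ([! B] Var p <~> (B ~> Var p))
| AN (B A : form P) : provable ([! B] ! A <~> (B ~> ! [! B] A))
| AC (B A C : form P) : provable ([! B] (A & C) <~> [! B] A & [! B] C)
| AA (B C A : form P) : provable ([! B] [! C] A <~> [! B & [! B] C] A)
| AW (B A : form P) : provable ([! B] W A <~> (B ~> W ([! B] A)))
| MP (A B : form P) : provable (A ~> B) -> provable A -> provable B
| REW (A B : form P) : provable (A <~> B) -> provable (W A <~> W B).

(* Main.v *)
Require Import Defs.

(** [[Wp]p] reduces to [B := Wp -> p], so by AW the goal reduces to [Wp -> W B].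
    Since [p] is equivalent to [p /\ B], REW turns [Wp] into [W(p /\ B)]; and [Wp]
    gives [~p] by WE, hence [~B], so WM yields [W B]. *)

(** Same encoding as [Imp] and [Iff], so that [inst] maps these schemes to the object-level
    connectives by mere computation. *)
Definition SImp (s t : scheme) : scheme := SNeg (SAnd s (SNeg t)).
Definition SIff (s t : scheme) : scheme := SAnd (SImp s t) (SImp t s).

Theorem proposition6p6 (P : Type) (p : P) : provable (Ann (W (Var p)) (W (Var p))).
Proof.
  pose (B := Imp (W (Var p)) (Var p)).
  assert (HB : provable (Iff (Var p) (And (Var p) B))).
  { refine (Taut (SIff (SVar 0) (SAnd (SVar 0) (SImp (SVar 1) (SVar 0))))
      (fun n => match n with 0 => Var p | _ => W (Var p) end) _).
    intro v; cbn; now destruct (v 0), (v 1). }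
  pose (a0 := SVar 0). pose (a1 := SVar 1). pose (a2 := SVar 2).
  pose (a3 := SVar 3). pose (a4 := SVar 4). pose (a5 := SVar 5).
  pose (sB := SImp a1 a0).
  (* One tautology carries all the Boolean reasoning; its five antecedents are proved below in
     order. [W] and announcement formulas are opaque letters, but [B] is spelled out as [sB], so
     that [a1] and [SNeg a0] refute it. *)
  refine (MP _ _ (MP _ _ (MP _ _ (MP _ _ (MP _ _ (Taut
    (SImp (SIff a1 a2)
    (SImp (SImp (SAnd a2 (SNeg sB)) a3)
    (SImp (SImp a1 (SNeg a0))
    (SImp (SIff a4 a3)
    (SImp (SIff a5 (SImp a1 a4)) a5)))))
    (fun n => match n with
              | 0 => Var p
              | 1 => W (Var p)
              | 2 => W (And (Var p) B)
              | 3 => W B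
              | 4 => W (Ann (W (Var p)) (Var p))
              | _ => Ann (W (Var p)) (W (Var p))
              end) _) _) _) _) _) _).
  - intro v; cbn.
    now destruct (v 0), (v 1), (v 2), (v 3), (v 4), (v 5).
  - exact (REW _ _ HB).
  - exact (WM (Var p) B).
  - exact (WE (Var p)).
  - exact (REW _ _ (AP (W (Var p)) p)).
  - exact (AW (W (Var p)) (Var p)).
Qed.
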